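(* Let the NURBS function $T_r$, defined on a knot grid $\mathcal{T}^h$ with knot grid size $h$, be the numerical solution, generated by the isogeometric least-squares collocation (IGA-L) method, of the boundary value problem $\mathcal{D}T=f$ in $\Omega$, $\mathcal{G}T=g$ on $\partial\Omega$ in dimension one, two, or three. Let $R(\boldsymbol{\eta})=(\mathcal{D}T(\boldsymbol{\eta})-\mathcal{D}T_r(\boldsymbol{\eta}))^2$ for $\boldsymbol{\eta}\in\Omega_0$, and let $e_h=\sum_kR(\boldsymbol{\vartheta}_k)$, where $\boldsymbol{\vartheta}_k\in\Omega_0$ are the collocation points. Suppose that (1) each knot interval of $T_r$ contains at least one collocation point; (2) the degree of each variable in $T_r$ is larger than the maximum order of the partial derivatives with respect to that variable appearing in $\mathcal{D}$; (3) the least-squares fitting error $e_h$ is bounded; (4) $R\in C^1(\Omega_0)$. If the differential operator $\mathcal{D}:V\to W$ is a stable operator, then $T_r$ converges to the analytical solution $T$ when $h\to0$, i.e. $\|T-T_r\|_V\to0$ as $h\to0$.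
   Context: Boundary value problem: $\Omega\subset\mathbb{R}^d$, $d\in\{1,2,3\}$; $\mathcal{D}:V\to W$ is a differential operator between Hilbert spaces $V,W$ with maximal derivative order $d_1\ge1$, $f:\Omega\to\mathbb{R}$ and $g:\partial\Omega\to\mathbb{R}$ are given, $\mathcal{G}T=g$ is the boundary condition, and the analytical solution satisfies $T\in C^{d_2}(\Omega)$, $d_2>d_1$. The norms $\|\cdot\|_V$ and $\|\cdot\|_W$ are assumed equivalent to the $L^2$ norm: there are positive constants $\alpha_V,\beta_V,\alpha_W,\beta_W$ with $\alpha_V\|\cdot\|_{L^2}\le\|\cdot\|_V\le\beta_V\|\cdot\|_{L^2}$ and $\alpha_W\|\cdot\|_{L^2}\le\|\cdot\|_W\le\beta_W\|\cdot\|_{L^2}$. Stable operator: $\mathcal{D}:V\to W$ is stable if there is a constant $C_{\mathcal{S}}>0$ such that $\|\mathcal{D}v\|_W\ge C_{\mathcal{S}}\|v\|_V$ for all $v$ in the domain $D(\mathcal{D})$ of $\mathcal{D}$. The domain $\Omega$ is parametrized by a NURBS mapping $\mathbf{F}:\Omega_0\to\Omega$, where $\Omega_0\subset\mathbb{R}^d$ is the parametric domain; functions on $\Omega$ are regarded as functions of the parameter $\boldsymbol{\eta}\in\Omega_0$. Knots: $T_r$ is a NURBS function (tensor-product for $d=2,3$) defined, in each parametric direction, on a knot sequence of the form $\{\underbrace{u_0,\dots,u_0}_{l_u+1},u_1,\dots,u_{n_u-1},\underbrace{u_{n_u},\dots,u_{n_u}}_{l_u+1}\}$ with $l_u$ the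 degree in that direction (similarly for $v$ and $w$). $\Omega_0$ is the product of the intervals $[u_0,u_{n_u}]$, $[v_0,v_{n_v}]$, $[w_0,w_{n_w}]$ (as many as the dimension). The knot intervals are the cells $[u_i,u_{i+1}]$, $[u_i,u_{i+1}]\times[v_j,v_{j+1}]$, or $[u_i,u_{i+1}]\times[v_j,v_{j+1}]\times[w_k,w_{k+1}]$, respectively; they form the knot grid $\mathcal{T}^h$, and the knot grid size $h$ is the maximum (Euclidean) diameter of these cells. IGA-L method: with $n$ the number of unknown coefficients of $T_r$, choose $m_1$ collocation points in the interior and $m_2$ on the boundary of the parametric domain, $m_1+m_2>n$; impose $\mathcal{D}T_r=f$ at the interior ones and $\mathcal{G}T_r=g$ at the boundary ones, obtaining a linear system $AX=b$ in the vector $X$ of coefficients, and determine $X$ by $\min_X\|AX-b\|^2$. Standing assumption: $A$ has full rank.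
   Formalization: Condition (4) is strengthened: besides R being C^1 for each T_r, its first partial derivatives are assumed bounded by one constant independent of h. With R merely C^1 for each h the claim is false, since badly placed collocation points make T_r diverge. *)

(* Defs.v *)
From HB Require Import structures.
From mathcomp Require Import all_boot all_order all_algebra.
From mathcomp Require Import all_classical all_reals all_analysis.

Set Implicit Arguments.
Unset Strict Implicit.
Unset Printing Implicit Defensive.

Import Order.TTheory GRing.Theory Num.Theory.
Import numFieldNormedType.Exports.

Local Open Scope classical_set_scope.
Local Open Scope ring_scope.

Section Geometry.
Variables (R : realType) (d : nat).
Implicit Types (A : set 'rV[R]_d) (a b : 'rV[R]_d).

(* The norm of ['rV_d] in the library is the maximum norm; cell diameters are
   Euclidean. *)
Definition edist (x y : 'rV[R]_d) : R :=
  Num.sqrt (\sum_(i < d) (x 0 i - y 0 i) ^+ 2).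

Definition diam A : R := sup [set edist x y | x in A & y in A].

Definition pbox a b : set 'rV[R]_d :=
  [set x | forall i, a 0 i <= x 0 i <= b 0 i].

Definition boundary A : set 'rV[R]_d := closure A `\` A°.

End Geometry.

Section L2.
Variables (R : realType) (d : nat).
Implicit Types (Om : set 'rV[R]_d) (v : 'rV[R]_d -> R).

Definition row_of (s : seq R) : 'rV[R]_d := \row_(i < d) s`_i.

(* Lebesgue measure on R^2 and R^3 is the product measure on [R * R] and
   [R * R * R]; functions are extended by 0 outside [Om].  The value for other
   [d] is never used. *)
Definition L2norm Om v : \bar R :=
  let w := fun s : seq R => (((v \_ Om) (row_of s))%:E)%E in
  let leb := @lebesgue_measure R in
  match d with
  | 1 => Lnorm leb 2%:E (fun x => w [:: x])
  | 2 => Lnorm (leb \x leb)%E 2%:E (fun p => w [:: p.1; p.2])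
  | 3 => Lnorm ((leb \x leb) \x leb)%E 2%:E (fun p => w [:: p.1.1; p.1.2; p.2])
  | _ => +oo%E
  end.

Definition L2measurable Om v : Prop :=
  let w := fun s : seq R => (v \_ Om) (row_of s) in
  match d with
  | 1 => measurable_fun [set: R] (fun x => w [:: x])
  | 2 => measurable_fun [set: R * R] (fun p => w [:: p.1; p.2])
  | 3 => measurable_fun [set: R * R * R] (fun p => w [:: p.1.1; p.1.2; p.2])
  | _ => False
  end.

Definition L2 Om : set ('rV[R]_d -> R) :=
  [set v | L2measurable Om v /\ (L2norm Om v < +oo)%E].

End L2.

Section Hilbert.
Variables (R : realType) (d : nat).
Local Notation fun_d := ('rV[R]_d -> R).
Implicit Types (Om : set 'rV[R]_d) (V W D : set fun_d) (ip : fun_d -> fun_d -> R).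

Definition subspace_of_fun V : Prop :=
  V 0 /\ forall c u v, V u -> V v -> V (c *: u + v).

Definition ipnorm ip (v : fun_d) : R := Num.sqrt (ip v v).

(* Functions that agree almost everywhere on [Om] represent the same vector;
   this is [hilbert_definite] and [hilbert_ae]. *)
Record hilbert_space_on Om V ip : Prop := HilbertSpaceOn {
  hilbert_subspace : subspace_of_fun V;
  hilbert_L2 : V `<=` L2 Om;
  hilbert_ae : forall u v, V u -> L2 Om v -> L2norm Om (u - v) = 0%E -> V v;
  hilbert_sym : forall u v, V u -> V v -> ip u v = ip v u;
  hilbert_linear : forall c u v w, V u -> V v -> V w ->
    ip (c *: u + v) w = c * ip u w + ip v w;
  hilbert_ge0 : forall v, V v -> 0 <= ip v v;
  hilbert_definite : forall v, V v -> ip v v = 0 <-> L2norm Om v = 0%E;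
  hilbert_complete : forall u : nat -> fun_d, (forall n, V (u n)) ->
    (forall e : R, 0 < e -> exists N : nat, forall m n : nat,
       (N <= m)%N -> (N <= n)%N -> ipnorm ip (u m - u n) < e) ->
    exists2 v, V v & ipnorm ip (u n - v) @[n --> \oo] --> (0 : R)
}.

Definition norm_equiv_L2 Om V ip (alpha beta : R) : Prop :=
  [/\ 0 < alpha, 0 < beta & forall v, V v ->
    (alpha%:E * L2norm Om v <= (ipnorm ip v)%:E)%E /\
    ((ipnorm ip v)%:E <= beta%:E * L2norm Om v)%E].

Definition stable ipV ipW (D : fun_d -> fun_d) (DomD : set fun_d) : Prop :=
  exists2 C : R, 0 < C &
    forall v, DomD v -> C * ipnorm ipV v <= ipnorm ipW (D v).

End Hilbert.

Section DifferentialOperator.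
Variables (R : realType) (d : nat).
Implicit Types (Om : set 'rV[R]_d) (v : 'rV[R]_d -> R) (s : seq 'I_d).

Definition partial (i : 'I_d) v : 'rV[R]_d -> R :=
  fun x => 'D_(delta_mx 0 i) v x.

Definition dseq s v : 'rV[R]_d -> R := foldr partial v s.

(* ['D_] is total, so the existence of the iterated derivative [dseq s v] on
   [Om] has to be stated separately. *)
Fixpoint derivable_seq Om s v : Prop :=
  if s is i :: s' then
    derivable_seq Om s' v /\
    forall x, Om x -> derivable (dseq s' v) x (delta_mx 0 i)
  else True.

(* C^k on an open set *)
Definition Ck Om (k : nat) v : Prop :=
  forall s, (size s <= k)%N ->
    derivable_seq Om s v /\ forall x, Om x -> {for x, continuous (dseq s v)}.

(* multi-indices with entries at most d1 *)
Definition midx (d1 : nat) := {ffun 'I_d -> 'I_d1.+1}.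

Variable d1 : nat.
Implicit Types (al : midx d1) (c : midx d1 -> 'rV[R]_d -> R).

Definition mlen al : nat := \sum_(i < d) al i.

Definition dirs al : seq 'I_d := flatten [seq nseq (al i) i | i <- enum 'I_d].

Definition diffop c v : 'rV[R]_d -> R :=
  fun x => \sum_(al : midx d1) c al x * dseq (dirs al) v x.

Definition appears Om c al : Prop := exists2 x, Om x & c al x != 0.

Definition has_max_order Om c : Prop :=
  (forall al, appears Om c al -> (mlen al <= d1)%N) /\
  (exists2 al, appears Om c al & mlen al = d1).

Definition has_partials Om c v : Prop :=
  forall al, appears Om c al -> derivable_seq Om (dirs al) v.

Record differential_operator Om c (V W DomD : set ('rV[R]_d -> R)) : Prop :=
  DifferentialOperator {
    do_order : has_max_order Om c;
    do_subspace : subspace_of_fun DomD;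
    do_domain : DomD `<=` V;
    do_partials : forall v, DomD v -> has_partials Om c v;
    do_range : forall v, DomD v -> W (diffop c v)
  }.

End DifferentialOperator.

Section NURBS.
Variables (R : realType) (d : nat).

(* [breaks] is u_0, ..., u_n; the knot sequence repeats u_0 and u_n
   [degree + 1] times. *)
Record knot_data := KnotData { degree : nat; breaks : seq R }.

Definition full_knots (k : knot_data) : seq R :=
  nseq (degree k) (head 0 (breaks k)) ++ breaks k ++
  nseq (degree k) (last 0 (breaks k)).

Definition nintervals (k : knot_data) : nat := (size (breaks k)).-1.

(* number of knots - degree - 1 *)
Definition nbasis (k : knot_data) : nat := (nintervals k + degree k)%N.

Definition knots_on (k : knot_data) (lo hi : R) : Prop :=
  [/\ sorted <=%R (breaks k), head 0 (breaks k) = lo, last 0 (breaks k) = hi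
    & lo < hi].

Definition simple_knots (k : knot_data) : Prop := sorted <%R (breaks k).

(* Cox - de Boor recursion, with the convention _ / 0 = 0.  The last nonempty
   knot span is closed on the right. *)
Fixpoint bspline (t : seq R) (p i : nat) (x : R) : R :=
  match p with
  | 0 => if (t`_i <= x < t`_i.+1) ||
            [&& t`_i < t`_i.+1, t`_i.+1 == last 0 t & x == last 0 t]
         then 1 else 0
  | q.+1 =>
      (x - t`_i) / (t`_(i + q.+1) - t`_i) * bspline t q i x +
      (t`_(i + q.+2) - x) / (t`_(i + q.+2) - t`_i.+1) * bspline t q i.+1 x
  end.

Record nurbs_space := NurbsSpace {
  knots : 'I_d -> knot_data;
  weight : {dffun forall i : 'I_d, 'I_(nbasis (knots i))} -> R
}.

Definition nidx (S : nurbs_space) :=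
  {dffun forall i : 'I_d, 'I_(nbasis (knots S i))}.

Definition tensor_bspline (S : nurbs_space) (j : nidx S) (eta : 'rV[R]_d) : R :=
  \prod_(i < d) bspline (full_knots (knots S i)) (degree (knots S i)) (j i) (eta 0 i).

Definition rbasis (S : nurbs_space) (j : nidx S) (eta : 'rV[R]_d) : R :=
  weight j * tensor_bspline j eta /
  \sum_(k : nidx S) weight k * tensor_bspline k eta.

Definition nurbs_fun (S : nurbs_space) (X : 'cV[R]_#|{: nidx S}|)
    (eta : 'rV[R]_d) : R :=
  \sum_(j < #|{: nidx S}|) X j 0 * rbasis (enum_val j) eta.

Definition nurbs_map (S : nurbs_space) (P : nidx S -> 'rV[R]_d)
    (eta : 'rV[R]_d) : 'rV[R]_d :=
  \sum_(j : nidx S) rbasis j eta *: P j.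

Definition nurbs_wf (S : nurbs_space) (a b : 'rV[R]_d) : Prop :=
  (forall i, knots_on (knots S i) (a 0 i) (b 0 i)) /\
  (forall j : nidx S, 0 < weight j).

Definition cidx (S : nurbs_space) :=
  {dffun forall i : 'I_d, 'I_(nintervals (knots S i))}.

Definition cell (S : nurbs_space) (c : cidx S) : set 'rV[R]_d :=
  [set eta | forall i,
    (breaks (knots S i))`_(c i) <= eta 0 i <= (breaks (knots S i))`_(c i).+1].

Definition grid_size (S : nurbs_space) : R :=
  \big[Num.max/0]_(c : cidx S) diam (cell c).

(* For an open domain [Om]: functions on the closed box [Om0] correspond to
   functions on the closure of [Om]. *)
Definition parametrizes (F : 'rV[R]_d -> 'rV[R]_d) (Om0 Om : set 'rV[R]_d) : Prop :=
  [/\ {within Om0, continuous F}, set_inj Om0 F, F @` Om0° = Om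
    & F @` Om0 = closure Om].

(* v o F^-1: a function of the parametric variable as a function on F(Om0) *)
Definition on_phys (F : 'rV[R]_d -> 'rV[R]_d) (Om0 : set 'rV[R]_d)
    (v : 'rV[R]_d -> R) : 'rV[R]_d -> R :=
  fun x => v (get [set eta | Om0 eta /\ F eta = x]).

(* C^1 on the closed box [K]: the partial derivatives in the interior extend
   continuously to [K]. *)
Definition C1_closed (K : set 'rV[R]_d) (r : 'rV[R]_d -> R) : Prop :=
  {within K, continuous r} /\
  forall i : 'I_d, exists p : 'rV[R]_d -> R, {within K, continuous p} /\
    forall x, K° x -> derivable r x (delta_mx 0 i) /\ partial i r x = p x.

End NURBS.

Section IGAL.
Variables (R : realType) (d : nat).
Local Notation fun_d := ('rV[R]_d -> R).

Record igal_data := IgalData {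
  ispace : nurbs_space R d;
  icoef : 'cV[R]_#|{: nidx ispace}|;
  nint : nat;
  nbnd : nat;
  theta_int : 'I_nint -> 'rV[R]_d;
  theta_bnd : 'I_nbnd -> 'rV[R]_d
}.

Definition nunknowns (S : igal_data) : nat := #|{: nidx (ispace S)}|.

Definition sqnorm m (y : 'cV[R]_m) : R := \sum_(k < m) y k 0 ^+ 2.

Section System.
Variables (Om0 : set 'rV[R]_d) (F : 'rV[R]_d -> 'rV[R]_d).
Variables (D G : fun_d -> fun_d) (f g : fun_d) (S : igal_data).

Definition phys_basis (j : 'I_(nunknowns S)) : fun_d :=
  on_phys F Om0 (rbasis (enum_val j)).

Definition numerical_solution : fun_d := on_phys F Om0 (nurbs_fun (icoef S)).

Definition igal_matrix : 'M[R]_(nint S + nbnd S, nunknowns S) :=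
  col_mx (\matrix_(k, j) D (phys_basis j) (F (theta_int k)))
         (\matrix_(k, j) G (phys_basis j) (F (theta_bnd k))).

Definition igal_rhs : 'cV[R]_(nint S + nbnd S) :=
  col_mx (\col_k f (F (theta_int k))) (\col_k g (F (theta_bnd k))).

Definition in_some (A : set 'rV[R]_d) : Prop :=
  (exists k, A (theta_int (i := S) k)) \/ (exists k, A (theta_bnd (i := S) k)).

Definition fitting_error (r : fun_d) : R :=
  \sum_k r (theta_int (i := S) k) + \sum_k r (theta_bnd (i := S) k).

(* [S] is a run of the IGA-L method on the box with corners [a], [b]; [classD] and
   [DomG] are sets of functions on which [D] and [G] are defined and linear, so
   that igal_matrix applied to the coefficients evaluates D T_r and G T_r. *)
Record igal_solution (a b : 'rV[R]_d) (classD DomG : set fun_d) : Prop :=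
  IgalSolution {
    igal_wf : nurbs_wf (ispace S) a b;
    igal_simple : forall i, simple_knots (knots (ispace S) i);
    igal_int : forall k, Om0° (theta_int (i := S) k);
    igal_bnd : forall k, (Om0 `\` Om0°) (theta_bnd (i := S) k);
    igal_size : (nunknowns S < nint S + nbnd S)%N;
    igal_basisD : forall j, classD (phys_basis j);
    igal_basisG : forall j, DomG (phys_basis j);
    igal_rank : \rank igal_matrix = minn (nint S + nbnd S) (nunknowns S);
    igal_min : forall Y : 'cV[R]_(nunknowns S),
      sqnorm (igal_matrix *m icoef S - igal_rhs) <=
      sqnorm (igal_matrix *m Y - igal_rhs)
  }.

End System.

(* linearity of the boundary operator on its domain; its values matter on
   [bd] only *)
Definition linear_on (bd : set 'rV[R]_d) (DomG : set fun_d) (G : fun_d -> fun_d) : Prop :=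
  subspace_of_fun DomG /\
  forall c u v, DomG u -> DomG v ->
    forall x, bd x -> G (c *: u + v) x = c * G u x + G v x.

End IGAL.

(* Main.v *)
Require Import Defs.
From HB Require Import structures.
From mathcomp Require Import all_boot all_order all_algebra.
From mathcomp Require Import all_classical all_reals all_analysis.
From mathcomp Require Import measurable_realfun ring lra.

(** The residuals [Res i] are nonnegative and, as their partial derivatives
    share a bound [M], they are Lipschitz with one common constant on the
    parametric box (mean value theorem along the coordinates, then continuity
    up to the boundary: [obox_lipschitz], [pbox_lipschitz]).

    Suppose that [Res i] exceeds [eps] at some point [x].  By the Lipschitz
    bound it exceeds [eps / 2] on a neighbourhood of [x] whose size depends
    only on [eps] and [M].  As soon as the grid is fine enough, a segment in
    this neighbourhood contains [N] points so far apart that the collocation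
    points of their cells are distinct, and these alone contribute at least
    [N * (eps / 2)] to the fitting error.  For large [N] this contradicts the
    bound on the fitting error.  Hence the residuals tend to 0 uniformly on the
    interior of the box.  This is [bounded_sum_sup_small], the heart of the
    proof, which is fed by the geometry of the grid ([cells_cover],
    [cell_dist_le]).

    Transported by the parametrization, it says that [D T - D (Tr i)], which is
    [D (T - Tr i)] by [diffopB], tends to 0 uniformly on [Omega].  As [Omega]
    lies in the continuous image of a compact box, it is bounded
    ([pbox_image_bounded]), so uniform smallness gives smallness in L^2
    ([L2norm_le]), hence in [W], and stability of [D] carries it over to [V]. *)

Set Implicit Arguments.
Unset Strict Implicit.
Unset Printing Implicit Defensive.

Import Order.TTheory GRing.Theory Num.Theory.
Import numFieldNormedType.Exports.

Local Open Scope classical_set_scope.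
Local Open Scope ring_scope.

(** * Lipschitz bounds on a closed box *)

Section Box.
Variables (R : realType) (d : nat).
Implicit Types (a b x y th : 'rV[R]_d) (r : 'rV[R]_d -> R).

Definition obox a b : set 'rV[R]_d := [set x | forall i, a 0 i < x 0 i < b 0 i].

Lemma interior_pbox a b : (pbox a b)° = obox a b.
Proof.
apply/seteqP; split=> x /=.
  move=> /nbhs_ballP[e /= e0 eK] i.
  have eP s : `|s| < e -> pbox a b (\row_j (x 0 j + s)).
    move=> se; apply: eK; split=> // k j; rewrite ord1 !mxE /ball /=.
    by rewrite opprD addrA subrr sub0r normrN.
  have he : `|e / 2| < e by rewrite gtr0_norm; lra.
  have he' : `|- (e / 2)| < e by rewrite normrN.
  have := eP _ he i; have := eP _ he' i; rewrite !mxE => /andP[? ?] /andP[? ?].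
  by apply/andP; split; lra.
move=> xK; rewrite /interior /=.
exists (fun _ j => [set` `]a 0 j, b 0 j[]).
  move=> k j; rewrite ord1; apply: near_in_itvoo; rewrite in_itv /=; exact: xK.
move=> y /= yP i; have := yP ord0 i; rewrite in_itv /= => /andP[? ?].
by apply/andP; split; apply/ltW.
Qed.

Lemma obox_pbox a b x : obox a b x -> pbox a b x.
Proof. by move=> xK i; have /andP[/ltW -> /ltW ->] := xK i. Qed.

Definition setc x (k : 'I_d) (t : R) : 'rV[R]_d :=
  \row_i if i == k then t else x 0 i.

Lemma setcD x k t h : setc x k (h + t) = h *: delta_mx 0 k + setc x k t.
Proof.
apply/rowP => i; rewrite !mxE eqxx /=; case: eqP => _.
  by rewrite mulr1.
by rewrite mulr0 add0r.
Qed.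

Lemma is_derive_setc r x k t :
  derivable r (setc x k t) (delta_mx 0 k) ->
  is_derive t 1 (fun s => r (setc x k s)) (partial k r (setc x k t)).
Proof.
move=> dr.
suff E : (fun h : R => h^-1 *: ((r \o setc x k) (h *: 1 + t) - r (setc x k t)))
   = (fun h : R => h^-1 *: (r (h *: delta_mx 0 k + setc x k t) - r (setc x k t))).
  split; first by rewrite /derivable E.
  by rewrite /partial /derive E.
by apply/funext => h /=; rewrite -setcD /GRing.scale /= mulr1.
Qed.

Lemma setc_lipschitz a b r (M : R) x k u v :
  (forall z, obox a b z ->
     derivable r z (delta_mx 0 k) /\ `|partial k r z| <= M) ->
  obox a b (setc x k u) -> obox a b (setc x k v) ->
  `|r (setc x k u) - r (setc x k v)| <= M * `|u - v|.
Proof.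
move=> dr; wlog uv : u v / u <= v => [hw ux vx|ux vx].
  have [uv|/ltW vu] := leP u v; first exact: hw.
  by rewrite distrC (distrC u); exact: hw.
have inb t : u <= t <= v -> obox a b (setc x k t).
  move=> /andP[ut tv] i; have := ux i; have := vx i; rewrite !mxE.
  by case: eqP => // _ /andP[? ?] /andP[? ?]; apply/andP; split; lra.
have [| |w] := @MVT_segment R (fun s => r (setc x k s))
    (fun s => partial k r (setc x k s)) u v uv.
- move=> t /itvP tuv; apply: is_derive_setc; apply: (dr _ _).1.
  by apply: inb; rewrite !tuv.
- apply: derivable_within_continuous => t /itvP tuv.
  have [] // := @is_derive_setc r x k t _; apply: (dr _ _).1.
  by apply: inb; rewrite !tuv.
move=> /itvP wuv; rewrite distrC => ->; rewrite normrM (distrC u).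
by rewrite ler_wpM2r//; apply: (dr _ _).2; apply: inb; rewrite !wuv.
Qed.

(** The open box is stable under replacing coordinates one at a time, so the
    passage from [x] to [y] splits into [d] moves along coordinate axes. *)
Lemma obox_lipschitz a b r (M delta : R) x y :
  0 <= M ->
  (forall z k, obox a b z ->
     derivable r z (delta_mx 0 k) /\ `|partial k r z| <= M) ->
  obox a b x -> obox a b y -> (forall i, `|x 0 i - y 0 i| <= delta) ->
  `|r x - r y| <= d%:R * M * delta.
Proof.
move=> M0 dr xK yK xy.
(* the first m coordinates have been moved from x to y *)
pose z m : 'rV[R]_d := \row_i if (i < m)%N then y 0 i else x 0 i.
have zK m : obox a b (z m).
  by move=> i; rewrite mxE; case: ifP.
have zS (k : 'I_d) : z k = setc (z k) k (x 0 k) /\ z k.+1 = setc (z k) k (y 0 k).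
  split; apply/rowP => i; rewrite !mxE.
    by case: eqP => // ->; rewrite ltnn.
  case: (eqVneq i k) => [->|nik]; first by rewrite ltnS leqnn.
  by rewrite ltnS leq_eqVlt (negbTE (nik : \val i != \val k)).
have main m : (m <= d)%N -> `|r x - r (z m)| <= m%:R * M * delta.
  elim: m => [|m IH] md.
    have -> : z 0%N = x by apply/rowP => i; rewrite mxE.
    by rewrite subrr normr0 !mul0r.
  have {IH} := IH (ltnW md).
  pose k := Ordinal md; have [Ek ES] := zS k.
  have : `|r (z m) - r (z m.+1)| <= M * delta.
    rewrite [in X in `|X - _|](Ek : z m = _) (ES : z m.+1 = _).
    apply: (@le_trans _ _ (M * `|x 0 k - y 0 k|)).
      apply: (@setc_lipschitz a b) => [w wK||]; first exact: dr.
        by rewrite -Ek; exact: zK.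
      by rewrite -ES; exact: zK.
    by rewrite ler_wpM2l.
  have := ler_distD (r (z m)) (r x) (r (z m.+1)).
  by rewrite -natr1 !mulrDl !mul1r; lra.
suff -> : y = z d by exact: main.
by apply/rowP => i; rewrite mxE ltn_ord.
Qed.

(** Transfers estimates from the open box to its closure: [y] is taken on the
    segment from [th] to [x], close to [th].  This choice keeps [y] inside the
    open box and makes it no farther from [x] than [th] is, so a Lipschitz
    estimate between [x] and [th] is not degraded. *)
Lemma pbox_approx a b r x th (e : R) : {within pbox a b, continuous r} ->
  obox a b x -> pbox a b th -> 0 < e ->
  exists y, [/\ obox a b y, `|r th - r y| <= e &
    forall i, `|x 0 i - y 0 i| <= `|x 0 i - th 0 i| ].
Proof.
move=> /subspace_continuousP rc xK thK e0.
have /cvgrPdist_le/(_ _ e0) := rc _ thK.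
rewrite near_withinE => /nbhs_ballP[rho /= rho0 hrho].
(* positive, at most 1, and with t * `|x - th| < rho *)
pose t := rho / (rho + `|x - th|).
have n0 : 0 <= `|x - th| by [].
have s0 : 0 < rho + `|x - th| by lra.
have t0 : 0 < t by rewrite divr_gt0.
have t1 : t <= 1 by rewrite ler_pdivrMr// mul1r lerDl.
pose y : 'rV[R]_d := th + t *: (x - th).
have yK : obox a b y.
  move=> i; rewrite !mxE.
  have /andP[xa xb] := xK i; have /andP[ta tb] := thK i.
  by apply/andP; split; nra.
exists y; split => //.
- apply: hrho; last exact: obox_pbox.
  rewrite -ball_normE /ball_ /= /y opprD addrA subrr sub0r normrN normrZ gtr0_norm//.
  rewrite /t mulrAC ltr_pdivrMr// ltr_pM2l//.
  by lra.
- move=> i; rewrite !mxE.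
  have -> : x 0 i - (th 0 i + t * (x 0 i - th 0 i)) = (1 - t) * (x 0 i - th 0 i).
    by ring.
  by rewrite normrM ger0_norm ?subr_ge0// ler_piMl//; lra.
Qed.

Lemma pbox_lipschitz a b r (M delta : R) x th :
  0 <= M -> {within pbox a b, continuous r} ->
  (forall z k, obox a b z ->
     derivable r z (delta_mx 0 k) /\ `|partial k r z| <= M) ->
  obox a b x -> pbox a b th -> (forall i, `|x 0 i - th 0 i| <= delta) ->
  `|r x - r th| <= d%:R * M * delta.
Proof.
move=> M0 rc dr xK thK xth; apply/ler_addgt0Pr => e e0.
have [y [yK ye xy]] := pbox_approx rc xK thK e0.
have := ler_distD (r y) (r x) (r th); rewrite (distrC (r y)).
have : `|r x - r y| <= d%:R * M * delta.
  by apply: (obox_lipschitz M0 dr) => // i; exact: le_trans (xy i) (xth i).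
by lra.
Qed.

Lemma pbox_ge0 a b r x th : {within pbox a b, continuous r} ->
  (forall z, obox a b z -> 0 <= r z) -> obox a b x -> pbox a b th -> 0 <= r th.
Proof.
move=> rc r0 xK thK; apply/ler_addgt0Pr => e e0.
have [y [yK ye _]] := pbox_approx rc xK thK e0.
by have := r0 _ yK; have := ler_norm (r y - r th); rewrite (distrC (r y)); lra.
Qed.

(** If [r x > eps], then [r > eps / 2] within distance [2 * delta] of [x].  On a
    segment of length [delta] parallel to the axis [i0] and issued from [x],
    take [N] points with spacing [delta / N > 2 * h].  The points [th k] found
    within [h] of them have distinct indices, so the sum of the values of [r]
    is at least [N * (eps / 2) > E].  The threshold [h0] is chosen before the
    function and the sample points, which makes the bound uniform over a
    family of grids. *)
Lemma bounded_sum_sup_small a b (L E eps : R) (i0 : 'I_d) : (a 0 i0 < b 0 i0) ->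
  0 <= L -> 0 < eps ->
  exists2 h0, 0 < h0 & forall (I : finType) (th : I -> 'rV[R]_d) r (h : R),
    h < h0 -> (forall k, pbox a b (th k)) ->
    (forall z, pbox a b z -> 0 <= r z) ->
    (forall x z (delta : R), obox a b x -> pbox a b z ->
       (forall i, `|x 0 i - z 0 i| <= delta) -> `|r x - r z| <= L * delta) ->
    (forall x, pbox a b x -> exists k, forall i, `|x 0 i - th k 0 i| <= h) ->
    \sum_k r (th k) <= E ->
    forall x, obox a b x -> r x <= eps.
Proof.
move=> ab L0 eps0.
pose delta := Num.min ((b 0 i0 - a 0 i0) / 2) (eps / (4 * (L + 1))).
have delta0 : 0 < delta.
  by rewrite lt_min !divr_gt0 ?subr_gt0//; lra.
have deltaab : delta <= (b 0 i0 - a 0 i0) / 2 by rewrite ge_min lexx.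
have deltaL : 4 * (L * delta) <= eps.
  have : delta <= eps / (4 * (L + 1)) by rewrite ge_min lexx orbT.
  by rewrite ler_pdivlMr; nra.
pose N := (Num.truncn (2 * `|E| / eps)).+1.
have NE : E < N%:R * (eps / 2).
  have : 2 * `|E| / eps < N%:R by exact: truncnS_gt.
  rewrite ltr_pdivrMr//; have := ler_norm E; lra.
have N1 : (1 : R) <= N%:R by rewrite ler1n.
exists (delta / (2 * N%:R)); first by rewrite divr_gt0//; lra.
move=> I th r h hh thK r0 rL hit rE x xK; rewrite leNgt; apply/negP => rx.
have step0 : 0 < delta / N%:R by rewrite divr_gt0//; lra.
have {hh}hstep : 2 * h < delta / N%:R.
  by move: hh; rewrite invfM mulrCA => ?; lra.
have hdelta : h <= delta.
  have : delta / N%:R <= delta by rewrite ler_pdivrMr; nra.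
  by lra.
(* the segment goes towards the farther of the two faces of the box
   orthogonal to i0, at distance at least delta from x *)
have [sg sg1 sgK] : exists2 sg : R, `|sg| = 1 & forall s, 0 <= s <= delta ->
    a 0 i0 <= x 0 i0 + sg * s <= b 0 i0.
  have /andP[xa xb] := xK i0.
  have [xm|/ltW xm] := leP (x 0 i0) ((a 0 i0 + b 0 i0) / 2).
    exists 1; rewrite ?normr1// => s /andP[? ?]; apply/andP; split; lra.
  exists (-1); rewrite ?normrN1// => s /andP[? ?]; apply/andP; split; lra.
pose xi (j : 'I_N) := setc x i0 (x 0 i0 + sg * (j%:R * (delta / N%:R))).
have jd (j : 'I_N) : 0 <= j%:R * (delta / N%:R) <= delta.
  have jN : (j%:R : R) <= N%:R by rewrite ler_nat ltnW.
  have Nd : N%:R * (delta / N%:R) = delta.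
    by rewrite mulrCA divff ?mulr1// gt_eqF//; lra.
  have := ler0n R j.
  by move=> ?; apply/andP; split; nra.
have xiK j : pbox a b (xi j).
  move=> i; rewrite mxE; case: eqP => [->|_]; first exact: sgK.
  exact: obox_pbox.
have xxi j i : `|x 0 i - xi j 0 i| <= delta.
  rewrite mxE; case: eqP => [->|_]; last by rewrite subrr normr0 ltW.
  rewrite opprD addrA subrr sub0r normrN normrM sg1 mul1r.
  by have /andP[? ?] := jd j; rewrite ger0_norm.
have [phi Hphi] := choice (fun j => hit _ (xiK j)).
have phi_inj : injective phi.
  move=> j j' jj'; apply/eqP; apply: contraT => nj.
  have := Hphi j i0; have := Hphi j' i0; rewrite jj' => h1 h2.
  have := ler_distD (th (phi j') 0 i0) (xi j 0 i0) (xi j' 0 i0).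
  rewrite (distrC (th _ _ _)).
  have -> : xi j 0 i0 - xi j' 0 i0 = sg * ((j%:R - j'%:R) * (delta / N%:R)).
    by rewrite !mxE eqxx; ring.
  rewrite normrM sg1 mul1r normrM (gtr0_norm step0).
  have : (1 : R) <= `|j%:R - j'%:R|.
    wlog jlt : j j' {jj' h1 h2 nj} / (j < j')%N => [hw|].
      move: nj; rewrite -val_eqE neq_ltn => /orP[/hw//|/hw]; by rewrite distrC.
    rewrite distrC -natrB ?(ltnW jlt)// normr_nat ler1n subn_gt0//.
  by nra.
have phiv j : eps / 2 <= r (th (phi j)).
  have xth i : `|x 0 i - th (phi j) 0 i| <= delta + h.
    have := ler_distD (xi j 0 i) (x 0 i) (th (phi j) 0 i).
    have := xxi j i; have := Hphi j i; lra.
  have := rL x (th (phi j)) (delta + h) xK (thK _) xth.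
  have := ler_norm (r x - r (th (phi j))); nra.
suff : N%:R * (eps / 2) <= \sum_k r (th k) by lra.
rewrite (bigID (mem [set phi j | j : 'I_N]%SET))/=.
rewrite big_imset /=; last by move=> ? ? _ _; exact: phi_inj.
have -> : N%:R * (eps / 2) = \sum_(j in 'I_N) (eps / 2).
  by rewrite sumr_const card_ord mulr_natl.
apply: ler_wpDr; last by apply: ler_sum => j _; exact: phiv.
by apply: sumr_ge0 => k _; apply: r0; exact: thK.
Qed.

End Box.

(** * Cells of the knot grid *)

Section Cells.
Variables (R : realType) (d : nat) (S : nurbs_space R d).
Implicit Types (a b x y : 'rV[R]_d).

Lemma break_interval (k : knot_data R) lo hi t : knots_on k lo hi ->
  lo <= t <= hi ->
  exists i : 'I_(nintervals k), (breaks k)`_i <= t <= (breaks k)`_i.+1.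
Proof.
case: k => p s; rewrite /nintervals /knots_on /= => -[_ hlo hhi lohi].
case: s hlo hhi => [lo0 hi0|u s /= -> {u} hhi].
  by move: lohi; rewrite -lo0 -hi0 ltxx.
move=> /andP[lot thi].
have main n : (n < size s)%N -> t <= s`_n ->
    exists i : 'I_(size s), (lo :: s)`_i <= t <= s`_i.
  elim: n => [|n IH] ns tn; first by exists (Ordinal ns); rewrite lot.
  have [tsn|/ltW snt] := leP t s`_n; first by apply: IH => //; exact: ltnW.
  by exists (Ordinal ns); rewrite /= snt.
case: s hhi main => [/= loE|u s hhi main].
  by move: lohi; rewrite loE ltxx.
apply: (main (size s)) => //; move: thi; rewrite -hhi.
by rewrite -[last lo _]/(last 0 (u :: s)) -nth_last.
Qed.

Lemma cells_cover a b x : (forall i, knots_on (knots S i) (a 0 i) (b 0 i)) ->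
  pbox a b x -> exists cl : cidx S, cell cl x.
Proof.
move=> kS xK; have [cl Hcl] := fin_all_exists (fun i => break_interval (kS i) (xK i)).
by exists [ffun i => cl i] => i; rewrite ffunE.
Qed.

Lemma cell_dist_le cl x y i : cell (S := S) cl x -> cell cl y ->
  `|x 0 i - y 0 i| <= grid_size S.
Proof.
move=> cx cy; apply: le_trans (le_bigmax _ _ cl).
pose l := \row_i (breaks (knots S i))`_(cl i).
pose u := \row_i (breaks (knots S i))`_(cl i).+1.
have xy : `|x 0 i - y 0 i| <= Defs.edist x y.
  rewrite /Defs.edist -sqrtr_sqr ler_wsqrtr// (bigD1 i)//= lerDl.
  by apply: sumr_ge0 => j _; exact: sqr_ge0.
apply: (le_trans xy); apply: ub_le_sup; last by exists x => //; exists y.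
(* sup is an upper bound only for a bounded set: the distances in the cell are
   at most the one between its corners l and u *)
exists (Num.sqrt (\sum_(j < d) (u 0 j - l 0 j) ^+ 2)) => _ [z cz [w cw <-]].
rewrite /Defs.edist ler_wsqrtr// ler_sum// => j _.
have := cz j; have := cw j; rewrite !mxE => /andP[? ?] /andP[? ?].
by rewrite -[leLHS]real_normK ?num_real// lerXn2r ?nnegrE ?subr_ge0 ?ler_norml//;
  [lra|apply/andP; split; lra].
Qed.

End Cells.

(** * Linearity of the differential operator *)

Section DiffOp.
Variables (R : realType) (d : nat).
Implicit Types (Om : set 'rV[R]_d) (u v : 'rV[R]_d -> R).

(** Iterated derivatives depend on the germ of the function, so the identity at
    order [s] has to hold on all of the open set to be differentiated again. *)
Lemma dseqB Om s u v : open Om -> derivable_seq Om s u -> derivable_seq Om s v ->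
  forall x, Om x -> dseq s (u - v) x = dseq s u x - dseq s v x.
Proof.
move=> oO; elim: s => [//|i s IH] /= [du du'] [dv dv'] x Ox.
have -> : partial i (dseq s (u - v)) x = partial i (dseq s u - dseq s v) x.
  apply: near_eq_derive; apply: (@filterS _ _ _ Om); last exact: open_nbhs_nbhs.
  by move=> y Oy; exact: IH.
by rewrite /partial deriveB; [|exact: du'|exact: dv'].
Qed.

(** Only the derivatives whose coefficient does not vanish identically on [Om]
    are known to exist; at a point of [Om] the other terms are multiplied
    by 0. *)
Lemma diffopB d1 (c : midx d d1 -> 'rV[R]_d -> R) Om u v : open Om ->
  has_partials Om c u -> has_partials Om c v ->
  forall x, Om x -> diffop c (u - v) x = diffop c u x - diffop c v x.
Proof.
move=> oO pu pv x Ox; rewrite /diffop -sumrB; apply: eq_bigr => al _.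
have [->|cx] := eqVneq (c al x) 0; first by rewrite !mul0r subrr.
have ap : appears Om c al by exists x.
by rewrite (dseqB oO (pu _ ap) (pv _ ap) Ox) mulrBr.
Qed.

End DiffOp.

(** * From uniform bounds to L2 bounds *)

Section L2bound.
Context (R : realType).

Lemma Lnorm2_le d (T : measurableType d) (mu : {measure set T -> \bar R})
  (f : T -> R) (B : set T) (C k : R) : measurable_fun setT f -> measurable B ->
  mu B = C%:E -> 0 <= k -> (forall x, B x -> `|f x| <= k) ->
  (forall x, ~ B x -> f x = 0) ->
  (Lnorm mu 2%:E (fun x => (f x)%:E) <= (k * Num.sqrt C)%:E)%E.
Proof.
move=> mf mB muB k0 fB fNB.
have C0 : 0 <= C by rewrite -lee_fin -muB.
have int_le : (\int[mu]_x (`|(f x)%:E| `^ 2) <= (k ^+ 2 * C)%:E)%E.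
  under eq_integral => x _ do
    rewrite abse_EFin poweR_EFin powR_mulrn// real_normK ?num_real//.
  rewrite EFinM -muB -integral_cst// [leRHS]integral_mkcond.
  apply: ge0_le_integral => //.
  - by move=> x _; rewrite lee_fin sqr_ge0.
  - by apply/measurable_EFinP; exact: measurable_funX.
  - by apply/(measurable_restrictT _ _).1 => //; exact: measurable_cst.
  - move=> x _; rewrite patchE; case: ifPn => [|] /=.
      rewrite inE => /fB fk.
      by rewrite lee_fin -[leLHS]real_normK ?num_real// lerXn2r ?nnegrE.
    by rewrite notin_setE => /fNB ->; rewrite expr0n.
rewrite unlock /=.
have i0 : (0 <= \int[mu]_x (`|(f x)%:E| `^ 2))%E.
  by apply: integral_ge0 => x _; exact: poweR_ge0.
apply: (le_trans (gt0_ler_poweR _ _ _ int_le)); rewrite ?invr_ge0//.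
  by rewrite in_itv /= i0 leey.
  by rewrite in_itv /= leey andbT lee_fin mulr_ge0// sqr_ge0.
rewrite poweR_EFin lee_fin powR12_sqrt ?mulr_ge0 ?sqr_ge0//.
by rewrite sqrtrM ?sqr_ge0// sqrtr_sqr ger0_norm.
Qed.

(** The extension of [v] by 0 is compared with [k] times the indicator function
    of a cube of side [2 * B] containing [Om], whose measure is explicit in
    each of the three dimensions. *)
Lemma L2norm_le d (Om : set 'rV[R]_d) (B : R) : (0 < d <= 3)%N -> 0 <= B ->
  (forall x, Om x -> forall i, `|x 0 i| <= B) ->
  exists2 C, 0 <= C & forall v (k : R), 0 <= k -> L2measurable Om v ->
    (forall x, Om x -> `|v x| <= k) -> (L2norm Om v <= (C * k)%:E)%E.
Proof.
move=> hd B0 OB; exists (Num.sqrt ((2 * B) ^+ d)); first exact: sqrtr_ge0.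
move=> v k k0 mv vk.
have in_le s : `|(v \_ Om) (row_of d s)| <= k.
  by rewrite patchE; case: ifPn => [|_]; rewrite ?normr0// inE => /vk.
have out0 s i : (i < d)%N -> ~ `[- B, B]%classic s`_i -> (v \_ Om) (row_of d s) = 0.
  move=> id sB; rewrite patchE; case: ifPn => //; rewrite inE => /OB/(_ (Ordinal id)).
  by rewrite mxE /= => h; case: sB; rewrite /= in_itv /= -ler_norml.
pose I : set R := `[- B, B]%classic.
have mI : measurable I by exact: measurable_itv.
have muI : lebesgue_measure I = (2 * B)%:E.
  rewrite lebesgue_measure_itv /= lte_fin; case: ifPn => h.
    by rewrite -EFinD; congr EFin; ring.
  by congr EFin; lra.
pose leb := @lebesgue_measure R.
have mII : measurable (I `*` I) by exact: measurableX.
have muII : (leb \x leb)%E (I `*` I) = ((2 * B) ^+ 2)%:E.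
  apply: (etrans (@product_measure1E _ _ _ _ R leb leb I I mI mI)).
  by rewrite expr2 EFinM; congr (_ * _)%E; exact: muI.
rewrite mulrC.
case: d Om OB v hd mv vk in_le out0 => [|[|[|[|//]]]] Om OB v // _ mv vk in_le out0.
- rewrite /L2norm.
  apply: (@Lnorm2_le _ _ lebesgue_measure
    (fun x => (v \_ Om) (row_of 1 [:: x])) I
    ((2 * B) ^+ 1) k) => //.
  by move=> x xI; exact: (out0 [:: x] 0%N).
- rewrite /L2norm.
  apply: (@Lnorm2_le _ _ (leb \x leb)%E
    (fun x => (v \_ Om) (row_of 2 [:: x.1; x.2])) (I `*` I)
    ((2 * B) ^+ 2) k) => //.
  move=> [x y] /= xI; apply: contrapT => h; apply: xI; split; apply: contrapT => /= n; apply: h.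
    exact: (out0 [:: x; y] 0%N).
  exact: (out0 [:: x; y] 1%N).
- rewrite /L2norm.
  apply: (@Lnorm2_le _ _ ((leb \x leb) \x leb)%E
    (fun x => (v \_ Om) (row_of 3 [:: x.1.1; x.1.2; x.2])) ((I `*` I) `*` I)
    ((2 * B) ^+ 3) k) => //.
  + exact: measurableX.
  + apply: (etrans (@product_measure1E _ _ _ _ R (leb \x leb)%E leb _ _ mII mI)).
    rewrite exprSr EFinM; congr (_ * _)%E; [exact: muII | exact: muI].
  move=> [[x y] z] /= xI; apply: contrapT => h; apply: xI.
  split; [split|]; apply: contrapT => /= n; apply: h.
  + exact: (out0 [:: x; y; z] 0%N).
  + exact: (out0 [:: x; y; z] 1%N).
  + exact: (out0 [:: x; y; z] 2%N).
Qed.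

Lemma pbox_image_bounded d (a b : 'rV[R]_d) (F : 'rV[R]_d -> 'rV[R]_d) :
  {within pbox a b, continuous F} ->
  exists2 B : R, 0 <= B & forall x i, pbox a b x -> `|F x 0 i| <= B.
Proof.
move=> cF.
have cK : compact (pbox a b).
  have -> : pbox a b = [set v : 'rV[R]_d | forall i, `[a 0 i, b 0 i]%classic (v ord0 i)].
    by apply/seteqP; split=> x /= h i; have := h i; rewrite /= in_itv.
  apply: (@rV_compact R d (fun i => `[a 0 i, b 0 i]%classic)) => i.
  exact: segment_compact.
have /compact_bounded[M [_ HM]] := continuous_compact cF cK.
exists (`|M| + 1) => // x i Kx.
have : `|F x| <= `|M| + 1.
  by apply: HM; [rewrite ltr_pwDr// ler_norm | exists x].
apply: le_trans; rewrite [leRHS]mx_normrE.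
exact: (le_bigmax _ (fun ij : 'I_1 * 'I_d => `|F x ij.1 ij.2|) (0, i)).
Qed.

End L2bound.

(** * Convergence *)

Theorem theorem4 (R : realType) (d : nat) (hd : (0 < d <= 3)%N)
  (* the domain and its NURBS parametrization *)
  (Omega : set 'rV[R]_d) (openOmega : open Omega)
  (a b : 'rV[R]_d) (NF : nurbs_space R d) (P : nidx NF -> 'rV[R]_d)
  (wfF : nurbs_wf NF a b)
  (paramF : parametrizes (nurbs_map P) (pbox a b) Omega)
  (* the Hilbert spaces V and W *)
  (V W : set ('rV[R]_d -> R)) (ipV ipW : ('rV[R]_d -> R) -> ('rV[R]_d -> R) -> R)
  (hilbertV : hilbert_space_on Omega V ipV)
  (hilbertW : hilbert_space_on Omega W ipW)
  (alphaV betaV alphaW betaW : R)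
  (equivV : norm_equiv_L2 Omega V ipV alphaV betaV)
  (equivW : norm_equiv_L2 Omega W ipW alphaW betaW)
  (* the operators D and G *)
  (d1 d2 : nat) (d1_gt0 : (0 < d1)%N) (d1_lt_d2 : (d1 < d2)%N)
  (c : midx d d1 -> 'rV[R]_d -> R) (DomD : set ('rV[R]_d -> R))
  (opD : differential_operator Omega c V W DomD)
  (G : ('rV[R]_d -> R) -> 'rV[R]_d -> R) (DomG : set ('rV[R]_d -> R))
  (linG : linear_on (boundary Omega) DomG G)
  (* the boundary value problem and its analytical solution *)
  (f g T : 'rV[R]_d -> R)
  (T_D : DomD T) (T_G : DomG T) (T_smooth : Ck Omega d2 T)
  (eqD : forall x, Omega x -> diffop c T x = f x)
  (eqG : forall x, boundary Omega x -> G T x = g x)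
  (* numerical solutions, along an arbitrary family of knot grids *)
  (J : Type) (run : J -> igal_data R d)
  (Tr := fun i => numerical_solution (pbox a b) (nurbs_map P) (run i))
  (igalS : forall i, igal_solution (pbox a b) (nurbs_map P) (diffop c) G f g
     (run i) a b [set v | has_partials Omega c v] DomG)
  (Tr_D : forall i, DomD (Tr i))
  (* the residual, extended by continuity to the boundary of the box *)
  (Res : J -> 'rV[R]_d -> R)
  (ResE : forall i eta, (pbox a b)° eta ->
     Res i eta = (diffop c T (nurbs_map P eta) -
                  diffop c (Tr i) (nurbs_map P eta)) ^+ 2)
  (h1 : forall i (cl : cidx (ispace (run i))), in_some (run i) (cell cl))
  (h2 : forall i (k : 'I_d) (al : midx d d1), appears Omega c al ->
     (al k < degree (knots (ispace (run i)) k))%N)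
  (h3 : exists E : R, forall i, fitting_error (run i) (Res i) <= E)
  (h4 : exists M : R, forall i, C1_closed (pbox a b) (Res i) /\
     forall eta (k : 'I_d), (pbox a b)° eta -> `|partial k (Res i) eta| <= M)
  (stableD : stable ipV ipW (diffop c) DomD)
  (H : set_system J) (filterH : Filter H)
  (h_to_0 : grid_size (ispace (run i)) @[i --> H] --> (0 : R)) :
  ipnorm ipV (T - Tr i) @[i --> H] --> (0 : R).
Proof.
have d0 : (0 < d)%N by case/andP: hd.
pose i0 := Ordinal d0.
have ab k : a 0 k < b 0 k by case: wfF => /(_ k) [].
have [cF _ FO FK] := paramF.
rewrite interior_pbox in FO.
pose mid : 'rV[R]_d := \row_k ((a 0 k + b 0 k) / 2).
have midK : obox a b mid.
  by move=> k; rewrite mxE; have := ab k => ?; apply/andP; split; lra.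
have [B B0 FB] := pbox_image_bounded cF.
have OB x : Omega x -> forall i, `|x 0 i| <= B.
  by rewrite -FO => -[eta /obox_pbox etaK <-] i; exact: FB.
have [CL CL0 HCL] := L2norm_le hd B0 OB.
have [Cs Cs0 HCs] := stableD.
have [_ betaW0 HW] := equivW.
have [M HM] := h4; have [E HE] := h3.
apply/cvgr0Pnorm_le => e e0.
(* the uniform bound on D (T - Tr i) that stability turns into e *)
pose k := e * Cs / (betaW * CL + 1).
have den0 : 0 < betaW * CL + 1 by rewrite ltr_wpDl// mulr_ge0// ltW.
have k0 : 0 < k by rewrite divr_gt0// mulr_gt0.
have [h0 h00 Hh0] := @bounded_sum_sup_small R d a b (d%:R * `|M|) E (k ^+ 2) i0 (ab i0)
  (mulr_ge0 (ler0n _ _) (normr_ge0 M)) (exprn_gt0 2 k0).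
have hH := cvgr0_norm_lt _ h_to_0 _ h00.
near=> i.
have hi : `|grid_size (ispace (run i))| < h0 by near: i; exact: hH.
have {hi} hi : grid_size (ispace (run i)) < h0 by apply: le_lt_trans hi; exact: ler_norm.
have [[Rc Rd] RM] := HM i.
have dR z l : obox a b z -> derivable (Res i) z (delta_mx 0 l) /\
    `|partial l (Res i) z| <= `|M|.
  rewrite -interior_pbox => zK; split; last exact: le_trans (RM _ _ zK) (ler_norm _).
  by have [p [_ /(_ _ zK)[]]] := Rd l.
have R0 z : pbox a b z -> 0 <= Res i z.
  move=> zK; apply: (pbox_ge0 Rc _ midK zK) => w; rewrite -interior_pbox => wK.
  by rewrite ResE// sqr_ge0.
have IS := igalS i.
(* interior and boundary collocation points as one family *)
pose th (l : 'I_(nint (run i)) + 'I_(nbnd (run i))) :=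
  match l with inl l => theta_int (i := run i) l | inr l => theta_bnd (i := run i) l end.
have thK l : pbox a b (th l).
  case: l => l /=; first exact: interior_subset (igal_int IS l).
  by case: (igal_bnd IS l).
have hit x : pbox a b x ->
    exists l, forall j, `|x 0 j - th l 0 j| <= grid_size (ispace (run i)).
  move=> xK; have [cl xcl] := cells_cover (igal_wf IS).1 xK.
  case: (h1 i cl) => -[l lcl]; [exists (inl l) | exists (inr l)] => j;
    exact: cell_dist_le xcl lcl.
have RE x : obox a b x -> Res i x <= k ^+ 2.
  apply: (Hh0 _ th _ _ hi thK R0 _ hit).
    move=> y z delta yK zK yz.
    exact: (pbox_lipschitz (normr_ge0 M) Rc dR yK zK yz).
  by rewrite big_sumType /=; exact: HE.
pose v := T - Tr i.
have vD : DomD v.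
  have -> : v = -1 *: Tr i + T by rewrite scaleN1r addrC.
  exact: (do_subspace opD).2.
have Dv x : Omega x -> `|diffop c v x| <= k.
  move=> Ox; rewrite (diffopB openOmega) //; try exact: (do_partials opD).
  move: Ox; rewrite -FO => -[eta etaK <-].
  have := RE _ etaK; rewrite ResE ?interior_pbox// -[X in X <= _]real_normK ?num_real//.
  by rewrite ler_sqr ?nnegrE// ltW.
have WDv := do_range opD vD.
have := (HW _ WDv).2.
have := HCL _ _ (ltW k0) (hilbert_L2 hilbertW WDv).1 Dv.
set n2 := L2norm _ _ => n2le nWle.
have {n2le nWle} : ipnorm ipW (diffop c v) <= betaW * (CL * k).
  rewrite -lee_fin; apply: (le_trans nWle).
  by rewrite EFinM lee_wpmul2l// lee_fin ltW.
have := HCs _ vD.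
rewrite ger0_norm ?sqrtr_ge0// => h1v h2v.
rewrite -(ler_pM2l Cs0); apply: (le_trans h1v); apply: (le_trans h2v).
rewrite /k mulrA mulrA ler_pdivrMr// [leRHS]mulrC (mulrC Cs).
by rewrite ler_wpM2r ?mulr_ge0 ?(ltW e0) ?(ltW Cs0)// lerDl.
Unshelve. all: by end_near. Qed.
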